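(* If $H$ is a connected graph such that $H\prec G$ for every bridgeless cubic graph $G$, then either $H\simeq P$, where $P$ is the Petersen graph, or $H$ exposes $S_4$.
   Context: Graphs are finite, undirected and loopless, but may contain parallel edges (both $H$ and the cubic graphs $G$); $\simeq$ denotes isomorphism of (multi)graphs. For a vertex $u$ of a graph $G$, $\partial_G u$ denotes the set of edges of $G$ incident to $u$. An $H$-colouring of $G$ is a map $f:E(G)\to E(H)$ that is a proper edge-colouring (adjacent edges of $G$ receive distinct edges of $H$) such that for every $u\in V(G)$ there exists $v\in V(H)$ with $f(\partial_G u)=\partial_H v$. We write $H\prec G$ ($H$ colours $G$) if $G$ admits an $H$-colouring. $S_4$ is the multigraph on four vertices $u,v,w,z$ with exactly the following five edges: two parallel edges between $v$ and $w$, one edge $uv$, one edge $uw$, and one edge $uz$. A graph $H$ exposes $S_4$ if there is a set $X$ of four vertices of $H$, consisting of three vertices of degree $3$ in $H$ and a further vertex of arbitrary degree in $H$, such that the induced multisubgraph $H[X]$ is isomorphic to $S_4$. *)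

(* Defs.v *)
From HB Require Import structures.
From mathcomp Require Import all_boot all_order all_algebra.

Set Implicit Arguments.
Unset Strict Implicit.
Unset Printing Implicit Defensive.

(* Finite loopless multigraphs: every edge has exactly two (distinct) ends, and
   distinct edges may have the same pair of ends. *)
Record mgraph := MGraph {
  vertex : finType;
  edge : finType;
  ends : edge -> {set vertex};
  card_ends : forall e : edge, #|ends e| = 2
}.

Section GraphNotions.

Variable G : mgraph.

Definition boundary (u : vertex G) : {set edge G} := [set e | u \in ends e].

Definition degree (u : vertex G) : nat := #|boundary u|.

Definition cubic : Prop := forall u : vertex G, degree u = 3.

(* Adjacency in the spanning subgraph of G whose edge set is F. *)
Definition adj_by (F : {set edge G}) : rel (vertex G) :=
  fun x y => [exists e in F, ends e == [set x; y]].

Definition connected : Prop :=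
  0 < #|vertex G| /\ forall x y : vertex G, connect (adj_by [set: edge G]) x y.

(* A bridge is an edge whose deletion increases the number of components. *)
Definition bridge (e : edge G) : Prop :=
  n_comp (adj_by [set: edge G]) predT < n_comp (adj_by [set~ e]) predT.

Definition bridgeless : Prop := forall e : edge G, ~ bridge e.

Section Induced.

Variable X : {set vertex G}.

Definition ind_vertex : finType := {x : vertex G | x \in X}.
Definition ind_edge : finType := {e : edge G | ends e \subset X}.
Definition ind_ends (e : ind_edge) : {set ind_vertex} :=
  [set x | val x \in ends (val e)].

Lemma card_ind_ends (e : ind_edge) : #|ind_ends e| = 2.
Proof.
rewrite -(card_ends (val e)) -(card_imset _ val_inj).
congr #|pred_of_set _|; apply/setP => x; apply/imsetP/idP => [[y]|xe].
  by rewrite inE => ye ->.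
by exists (Sub x (subsetP (valP e) x xe)); rewrite ?inE SubK.
Qed.

Definition induced : mgraph := MGraph card_ind_ends.

End Induced.

End GraphNotions.

Definition isomorphic (G1 G2 : mgraph) : Prop :=
  exists (f : vertex G1 -> vertex G2) (g : edge G1 -> edge G2),
    [/\ bijective f, bijective g & forall e, ends (g e) = f @: ends e].

Definition proper_edge_colouring (G : mgraph) (C : Type) (f : edge G -> C) :=
  forall e1 e2 : edge G,
    e1 <> e2 -> ends e1 :&: ends e2 != set0 -> f e1 <> f e2.

Definition colouring (H G : mgraph) (f : edge G -> edge H) : Prop :=
  proper_edge_colouring f /\
  forall u : vertex G, exists v : vertex H, f @: boundary u = boundary v.

Definition colours (H G : mgraph) : Prop :=
  exists f : edge G -> edge H, colouring f.

(* The Petersen graph: an outer 5-cycle on the vertices [inl i], an inner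
   pentagram on the vertices [inr i], and spokes joining [inl i] to [inr i]. *)
Definition petersen_ends (e : 'Z_5 + 'Z_5 + 'Z_5) : {set 'Z_5 + 'Z_5} :=
  match e with
  | inl (inl i) => [set inl i; inl (i + 1)%R]
  | inl (inr i) => [set inl i; inr i]
  | inr i => [set inr i; inr (i + 2%:R)%R]
  end.

Lemma card_petersen_ends e : #|petersen_ends e| = 2.
Proof.
by case: e => [[]|] [[|[|[|[|[|m]]]]] lt_m5] //; rewrite /= cards2.
Qed.

Definition petersen : mgraph := MGraph card_petersen_ends.

(* The vertices u, v, w, z are numbered 0, 1, 2, 3. *)
Definition S4_ends (e : 'I_5) : {set 'I_4} :=
  let u := inord 0 in let v := inord 1 in
  let w := inord 2 in let z := inord 3 in
  tnth [tuple [set v; w]; [set v; w]; [set u; v]; [set u; w]; [set u; z]] e.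

Lemma card_S4_ends e : #|S4_ends e| = 2.
Proof.
by case: e => [[|[|[|[|[|m]]]]] lt_m5] //;
  rewrite /S4_ends /tnth /= cards2 -val_eqE /= !inordK.
Qed.

Definition S4 : mgraph := MGraph card_S4_ends.

(* The exceptional vertex x0 may have any degree, including 3. *)
Definition exposes_S4 (H : mgraph) : Prop :=
  exists X : {set vertex H},
    [/\ #|X| = 4,
        exists2 x0, x0 \in X & forall x, x \in X :\ x0 -> degree x = 3
      & isomorphic (induced X) S4].

(* Main.v *)
Require Import Defs.
From mathcomp Require Import all_boot all_order all_algebra.

(** Since the Petersen graph P is bridgeless and cubic, H colours P, and this
    alone suffices. Each vertex of P is coloured by a vertex star of H of size 3.
    An edge of H lies in at most two vertex stars, so no colour occurs in three
    distinct stars. If u, v, w are stars such that v and w share two edges and u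
    contains the other edge of v and the other edge of w, then their centres,
    together with the end of the remaining edge of u, expose S4. An exhaustive
    search over the colour patterns on the 15 edges of P that avoid both
    situations leaves only the injective one, and an injective colouring of P by
    a connected graph H is an isomorphism. *)

Set Implicit Arguments.
Unset Strict Implicit.
Unset Printing Implicit Defensive.

(** * Ends of edges and bridges *)

Section Multigraphs.

Variable G : mgraph.
Implicit Types (e : edge G) (x y : vertex G).

Lemma mem_boundary e x : (e \in boundary x) = (x \in ends e).
Proof. by rewrite inE. Qed.

Lemma ends_set2 e x y : x != y -> x \in ends e -> y \in ends e ->
  ends e = [set x; y].
Proof.
move=> xy xe ye; apply/esym/eqP; rewrite eqEcard card_ends cards2 xy leqnn andbT.
by apply/subsetP => z; rewrite !inE => /orP[] /eqP->.
Qed.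

Lemma ends_other e x : x \in ends e -> exists2 y, x != y & ends e = [set x; y].
Proof.
move=> xe; have /eqP/cards2P[a [b [ab Dab]]] := card_ends e.
move: xe; rewrite {1}Dab !inE => /orP[] /eqP->; first by exists b.
by exists a; [rewrite eq_sym | rewrite Dab setUC].
Qed.

(** Pigeonhole on the two ends; this is why a colour cannot lie in three distinct vertex stars. *)
Lemma ends_repeat e x y z : x \in ends e -> y \in ends e -> z \in ends e ->
  [|| x == y, x == z | y == z].
Proof.
move=> xe ye ze; apply: contraT; rewrite !negb_or => /and3P[xy xz yz].
by move: ze; rewrite (ends_set2 xy xe ye) !inE eq_sym (negPf xz) eq_sym (negPf yz).
Qed.

Lemma adj_by_sym (F : {set edge G}) : symmetric (adj_by F).
Proof. by move=> x y; rewrite /adj_by setUC. Qed.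

(** A path through [e] can be rerouted along the given connection, so deleting [e] preserves the
    connectivity relation and with it the number of components. *)
Lemma not_bridge e x y : ends e = [set x; y] ->
  connect (adj_by [set~ e]) x y -> ~ bridge e.
Proof.
move=> De xy; rewrite /bridge.
have symF (F : {set edge G}) : connect_sym (adj_by F).
  by apply: sym_connect_sym; apply: adj_by_sym.
suff eqc : connect (adj_by [set: edge G]) =2 connect (adj_by [set~ e]).
  by rewrite (eq_n_comp eqc) ltnn.
move=> a b; apply/idP/idP; apply: connect_sub => {a b} a b /existsP[e' /andP[_ De']].
  have [ee'|ne] := eqVneq e' e; last first.
    by apply: connect1; apply/existsP; exists e'; rewrite !inE ne.
  have ab : a != b by have := card_ends e'; rewrite (eqP De') cards2; case: eqP.
  move: De'; rewrite ee' De => /eqP Dxy.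
  have : a \in [set x; y] by rewrite Dxy !inE eqxx.
  have : b \in [set x; y] by rewrite Dxy !inE eqxx orbT.
  rewrite !inE => /orP[] /eqP-> /orP[] /eqP-> //; first by rewrite symF.
by apply: connect1; apply/existsP; exists e'; rewrite !inE.
Qed.

End Multigraphs.

(** * Building isomorphisms of multigraphs *)

Lemma isomorphicP (H G : mgraph) (phi : vertex G -> vertex H)
    (psi : edge G -> edge H) :
  bijective phi -> bijective psi -> (forall e, ends (psi e) = phi @: ends e) ->
  isomorphic H G.
Proof.
case=> phi' phiK phi'K [psi' psiK psi'K] Dends.
exists phi', psi'; split; [by exists phi | by exists psi |] => e.
rewrite -{2}(psi'K e) Dends -imset_comp -[LHS]imset_id.
by apply: eq_imset => x /=; rewrite phiK.
Qed.

Lemma inj_surj_bij (T1 T2 : finType) (f : T1 -> T2) :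
  injective f -> (forall y, exists x, f x = y) -> bijective f.
Proof.
move=> f_inj f_surj; apply: inj_card_bij => //.
rewrite -(card_codom f_inj); apply: subset_leq_card; apply/subsetP => y _.
by have [x <-] := f_surj y; apply: codom_f.
Qed.

(** Both maps become bijective once corestricted to the induced subgraph; the last hypothesis
    excludes extra edges among the image vertices. *)
Lemma induced_isomorphic (H G : mgraph) (phi : vertex G -> vertex H)
    (psi : edge G -> edge H) :
  injective phi -> injective psi -> (forall e, ends (psi e) = phi @: ends e) ->
  (forall h, ends h \subset phi @: setT -> exists e, psi e = h) ->
  isomorphic (induced (phi @: setT)) G.
Proof.
move=> phi_inj psi_inj Dends psi_surj; set X := phi @: setT.
have phiX x : phi x \in X by apply: imset_f.
have psiX e : ends (psi e) \subset X by rewrite Dends imsetS // subsetT.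
pose phi' x : vertex (induced X) := Sub (phi x) (phiX x).
pose psi' e : edge (induced X) := Sub (psi e) (psiX e).
apply: (@isomorphicP _ _ phi' psi').
- apply: inj_surj_bij => [x y /(congr1 val)/phi_inj //|[y Xy]].
  have /imsetP[x _ Dy] := Xy; by exists x; apply: val_inj.
- apply: inj_surj_bij => [x y /(congr1 val)/psi_inj //|[h Xh]].
  have [e De] := psi_surj h Xh; by exists e; apply: val_inj.
move=> e; apply/setP=> -[y Xy]; rewrite inE /= Dends.
apply/imsetP/imsetP => -[x xe Dx]; exists x => //; last exact: (congr1 val Dx).
exact: val_inj.
Qed.

(** * Recognising an exposed [S4] *)

(** The two common edges [a], [b] of [v] and [w] are parallel. The third edges [c] of [v] and [d] of
    [w] must lie at [u], so they are [uv] and [uw]. The third edge [e] of [u] leads to the remaining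
    vertex [z]. *)
Lemma exposes_S4_intro (H : mgraph) (u v w : vertex H) :
    degree u = 3 -> degree v = 3 -> degree w = 3 ->
    #|boundary v :&: boundary w| = 2 ->
    boundary w \subset boundary v :|: boundary u ->
    boundary v \subset boundary w :|: boundary u ->
  exposes_S4 H.
Proof.
rewrite /degree => du dv dw dvw /subsetP sw /subsetP sv.
have vw : v != w by apply/eqP=> Dv; move: dvw; rewrite Dv setIid dw.
have /cards1P[c Dc] : #|boundary v :\: boundary w| == 1.
  by rewrite cardsD dv dvw.
have /cards1P[d Dd] : #|boundary w :\: boundary v| == 1.
  by rewrite cardsD setIC dvw dw.
have /eqP/cards2P[a [b [ab Dab]]] := dvw.
have : c \in [set c] by rewrite inE.
have : d \in [set d] by rewrite inE.
have : a \in [set a; b] by rewrite !inE eqxx.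
have : b \in [set a; b] by rewrite !inE eqxx orbT.
rewrite -{1}Dc -{1}Dd -{1 2}Dab.
move=> /setIP[bv bw] /setIP[av aw] /setDP[dw' ndv] /setDP[cv ncw].
have cu : c \in boundary u by have := sv c cv; rewrite in_setU (negPf ncw).
have du' : d \in boundary u by have := sw d dw'; rewrite in_setU (negPf ndv).
have uv : u != v by apply: contraNneq ndv => <-.
have uw : u != w by apply: contraNneq ncw => <-.
have cd : c != d by apply: contraNneq ncw => ->.
have memv h : h \in boundary v -> [|| h == a, h == b | h == c].
  move=> hv; have [hw|nhw] := boolP (h \in boundary w).
    have : h \in [set a; b] by rewrite -Dab inE hv.
    by rewrite !inE => /orP[] -> //; rewrite orbT.
  have : h \in [set c] by rewrite -Dc in_setD nhw.
  by rewrite !inE => ->; rewrite !orbT.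
have memw h : h \in boundary w -> [|| h == a, h == b | h == d].
  move=> hw; have [hv|nhv] := boolP (h \in boundary v).
    have : h \in [set a; b] by rewrite -Dab inE hv.
    by rewrite !inE => /orP[] -> //; rewrite orbT.
  have : h \in [set d] by rewrite -Dd in_setD nhv.
  by rewrite !inE => ->; rewrite !orbT.
have /cards1P[e De] : #|boundary u :\: [set c; d]| == 1.
  rewrite cardsD du (setIidPr _) ?cards2 ?cd //.
  by apply/subsetP => h; rewrite !in_set2 => /orP[] /eqP->.
have : e \in [set e] by rewrite inE.
rewrite -{1}De in_setD in_set2 negb_or => /andP[/andP[ec ed] eu].
have memu h : h \in boundary u -> [|| h == c, h == d | h == e].
  move=> hu; have [/set2P[]->|nh] := boolP (h \in [set c; d]);
    rewrite ?eqxx ?orbT //.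
  have : h \in [set e] by rewrite -De in_setD nh.
  by rewrite inE => ->; rewrite !orbT.
rewrite !mem_boundary in av aw bv bw cu cv ncw du' dw' ndv eu.
have Ea := ends_set2 vw av aw.
have Eb := ends_set2 vw bv bw.
have Ec := ends_set2 uv cu cv.
have Ed := ends_set2 uw du' dw'.
have nau : u \notin ends a by rewrite Ea !inE negb_or uv uw.
have nbu : u \notin ends b by rewrite Eb !inE negb_or uv uw.
have ea : e != a by apply: contraNneq nau => <-.
have eb : e != b by apply: contraNneq nbu => <-.
have ca : c != a by apply: contraNneq ncw => ->.
have cb : c != b by apply: contraNneq ncw => ->.
have da : d != a by apply: contraNneq ndv => ->.
have db : d != b by apply: contraNneq ndv => ->.
have [z uz Ee] := ends_other eu.
(* The star of [v] is exhausted by [a], [b], [c], so [e] cannot end there; likewise for [w]. *)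
have vz : v != z.
  apply/eqP=> Dz; have /memv : e \in boundary v
    by rewrite mem_boundary Ee Dz !inE eqxx orbT.
  by rewrite (negPf ea) (negPf eb) (negPf ec).
have wz : w != z.
  apply/eqP=> Dz; have /memw : e \in boundary w
    by rewrite mem_boundary Ee Dz !inE eqxx orbT.
  by rewrite (negPf ea) (negPf eb) (negPf ed).
pose phi (i : vertex S4) := tnth [tuple u; v; w; z] i.
pose psi (i : edge S4) := tnth [tuple a; b; c; d; e] i.
have phi_inj : injective phi.
  apply/tuple_uniqP; rewrite /= !inE !negb_or uv uw uz vw vz wz //.
have psi_inj : injective psi.
  apply/tuple_uniqP; rewrite /= !inE !negb_or ab.
  rewrite (eq_sym a c) (eq_sym a d) (eq_sym a e) (eq_sym b c) (eq_sym b d).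
  by rewrite (eq_sym b e) (eq_sym c e) (eq_sym d e) ca da ea cb db eb cd ec ed.
have phiE k : k < 4 -> phi (inord k) = nth u [:: u; v; w; z] k.
  by move=> lt_k4; rewrite /phi (tnth_nth u) inordK.
have Dphi : phi @: setT = [set u; v; w; z].
  apply/setP=> x; apply/imsetP/idP => [[[[|[|[|[|m]]]] lti] // _ ->]|].
  - by rewrite !inE /phi /tnth /= eqxx ?orbT.
  - by rewrite !inE /phi /tnth /= eqxx ?orbT.
  - by rewrite !inE /phi /tnth /= eqxx ?orbT.
  - by rewrite !inE /phi /tnth /= eqxx ?orbT.
  rewrite !inE -!orbA => /or4P[] /eqP->; rewrite -?phiE.
  - by exists (inord 0); rewrite ?inE ?phiE.
  - by exists (inord 1); rewrite ?inE ?phiE.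
  - by exists (inord 2); rewrite ?inE ?phiE.
  - by exists (inord 3); rewrite ?inE ?phiE.
exists (phi @: setT); split.
- by rewrite card_imset // cardsT card_ord.
- exists z => [|x]; rewrite Dphi ?inE ?eqxx ?orbT //.
  by case/andP=> /negPf-> /=; rewrite orbF -orbA => /or3P[] /eqP->.
apply: (@induced_isomorphic H S4 phi psi) => //.
  by case=> [[|[|[|[|[|m]]]]] lti] //;
    rewrite /S4 /= /S4_ends /psi /tnth /= imsetU1 imset_set1 !phiE.
move=> h; rewrite Dphi => /subsetP hX.
suff : h \in [tuple a; b; c; d; e] by move=> /tnthP[i ->]; exists i.
have [x [y [xy Dh]]] : exists x y, x != y /\ ends h = [set x; y].
  have /eqP/cards2P[x [y [xy Dh]]] := card_ends h; by exists x, y.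
(* The stars of [u], [v], [w] are completely known, and an edge inside the set cannot have both ends
   equal to [z]. *)
suff : [|| u \in ends h, v \in ends h | w \in ends h].
  rewrite -!mem_boundary => /or3P[/memu|/memv|/memw] /or3P[] /eqP->;
    by rewrite !inE eqxx ?orbT.
have [xh yh] : x \in ends h /\ y \in ends h by rewrite Dh !inE !eqxx orbT.
have := hX x xh; have := hX y yh; rewrite !inE -!orbA.
case/or4P=> /eqP Dy; rewrite -?Dy ?yh ?orbT //.
case/or4P=> /eqP Dx; rewrite -?Dx ?xh ?orbT //.
by move: xy; rewrite Dx Dy eqxx.
Qed.

(** * Injective colourings *)

Section Colourings.

Variables (H G : mgraph) (f : edge G -> edge H).
Hypothesis f_col : colouring f.

Lemma colouring_inj_boundary (x : vertex G) : {in boundary x &, injective f}.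
Proof.
move=> e1 e2; rewrite !inE => xe1 xe2 Df; apply/eqP/contraT => /eqP ne.
case: (f_col.1 e1 e2 ne) => //; apply/set0Pn; exists x.
by rewrite inE xe1.
Qed.

(** Sending each vertex to the centre of its image star gives an injective [phi] compatible with [f]
    on ends. Every edge of [H] at [phi x] is the colour of an edge at [x], so the image of [phi] is
    closed under adjacency, and connectedness makes it everything. *)
Lemma inj_colouring_isomorphic :
    connected H -> 0 < #|vertex G| -> injective (@boundary G) -> injective f ->
  isomorphic H G.
Proof.
move=> [_ H_conn] /card_gt0P[x0 _] bd_inj f_inj.
have [phi Dphi] : exists phi, forall x, f @: boundary x = boundary (phi x).
  have P x : exists v, f @: boundary x == boundary v.
    by have [v ->] := f_col.2 x; exists v.
  by exists (fun x => xchoose (P x)) => x; apply/eqP/(xchooseP (P x)).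
have phi_inj : injective phi.
  move=> x y Dxy; apply: bd_inj; apply: (imset_inj f_inj).
  by rewrite !Dphi Dxy.
have phi_ends e x : x \in ends e -> phi x \in ends (f e).
  by move=> xe; rewrite -mem_boundary -Dphi imset_f // mem_boundary.
have Dends e : ends (f e) = phi @: ends e.
  apply/esym/eqP; rewrite eqEcard card_imset // !card_ends leqnn andbT.
  by apply/subsetP=> _ /imsetP[x xe ->]; apply: phi_ends.
have edge_surj x h : phi x \in ends h -> exists e, f e = h.
  by rewrite -mem_boundary -Dphi => /imsetP[e _ ->]; exists e.
have phi_surj v : exists x, phi x = v.
  have clos : closed (adj_by [set: edge H]) (codom phi).
    apply: intro_closed => [|a b /existsP[h /andP[_ /eqP Dh]] /codomP[x Dx]].
      by apply: sym_connect_sym; apply: adj_by_sym.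
    have [|e De] := edge_surj x h; first by rewrite Dh Dx !inE eqxx.
    have : b \in ends h by rewrite Dh !inE eqxx orbT.
    by rewrite -De Dends => /imsetP[y _ ->]; apply: codom_f.
  have := closed_connect clos (H_conn (phi x0) v).
  by rewrite codom_f => /esym/codomP[x ->]; exists x.
apply: (@isomorphicP _ _ phi f) => //; apply: inj_surj_bij => // h.
have /eqP/cards2P[a [b [_ Dh]]] := card_ends h; have [x Dx] := phi_surj a.
by apply: (edge_surj x); rewrite Dh Dx !inE eqxx.
Qed.

End Colourings.

(** * Local constraints on triples of stars *)

Section CompatibleTriples.

Variable T : eqType.
Implicit Types u v w : seq T.

(* The first conjunct expresses that an edge of H has only two ends; the second
   forbids three vertices of H that span a copy of S4 minus its vertex z. *)
Definition compatible u v w :=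
  (has (fun x => (x \in v) && (x \in w)) u ==>
     [|| all (mem v) u, all (mem w) u | all (mem w) v]) &&
  ~~ [&& count (mem v) w == 2, all (fun x => (x \in v) || (x \in u)) w
       & all (fun x => (x \in w) || (x \in u)) v].

End CompatibleTriples.

(** This permits renaming the edges of [H] as numbers for the search. *)
Lemma compatible_map (T1 T2 : eqType) (h : T1 -> T2) u v w :
  injective h -> compatible (map h u) (map h v) (map h w) = compatible u v w.
Proof.
move=> h_inj; have mem_h s x : (h x \in map h s) = (x \in s) by apply: mem_map.
rewrite /compatible has_map !all_map count_map.
congr ((_ ==> [|| _, _ | _]) && ~~ [&& _ == 2, _ & _]);
  first [apply: eq_has | apply: eq_all | apply: eq_count] => x /=;
  by rewrite ?mem_h.
Qed.

(** The first conjunct holds for any three vertex stars: an edge common to all of them forces two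
    centres, hence two stars, to coincide. Only the second can fail, and its failure is the
    configuration that yields [S4]. *)
Lemma incompatible_exposes (H : mgraph) (a b c : vertex H) (u v w : seq (edge H)) :
    uniq u -> uniq v -> uniq w -> size u = 3 -> size v = 3 -> size w = 3 ->
    boundary a =i u -> boundary b =i v -> boundary c =i w ->
  ~~ compatible u v w -> exposes_S4 H.
Proof.
move=> Uu Uv Uw su sv sw Du Dv Dw; rewrite negb_and negbK; case/orP.
  case/negP; apply/implyP=> /hasP[x].
  rewrite -Du -Dv -Dw !mem_boundary => xa /andP[xb xc].
  have eq_sub p q s t : boundary p =i s -> boundary q =i t -> p = q ->
      all (mem t) s.
    by move=> Ds Dt Dp; apply/allP=> y; rewrite -Ds Dp Dt.
  by case/or3P: (ends_repeat xa xb xc) => /eqP Dab; apply/or3P;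
    [apply: Or31 | apply: Or32 | apply: Or33]; apply: eq_sub Dab.
have deg p s : uniq s -> size s = 3 -> boundary p =i s -> degree p = 3.
  by move=> Us <- Ds; rewrite /degree (eq_card Ds) (card_uniqP Us).
case/and3P=> /eqP vw2 /allP wsub /allP vsub.
apply: (@exposes_S4_intro _ a b c);
  [exact: deg Du | exact: deg Dv | exact: deg Dw | | |].
- rewrite -vw2 -size_filter -(card_uniqP (filter_uniq _ Uw)).
  by apply: eq_card => x; rewrite in_setI mem_filter Dv Dw.
- by apply/subsetP=> x; rewrite in_setU Dw Dv Du => /wsub.
by apply/subsetP=> x; rewrite in_setU Dw Dv Du => /vsub.
Qed.

(** * The exhaustive search *)

(* The vertex stars of the Petersen graph, for a numbering of the edges that
   keeps the search tree small. *)
Definition stars : seq (seq nat) :=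
  [:: [:: 0; 1; 2]; [:: 3; 4; 5]; [:: 2; 6; 5]; [:: 7; 4; 8]; [:: 0; 9; 7];
      [:: 10; 1; 11]; [:: 12; 10; 3]; [:: 11; 13; 8]; [:: 14; 6; 13];
      [:: 9; 12; 14]].

(* The sequence s lists the colours of the edges numbered 0, ..., size s - 1;
   only the constraints involving the last of these edges are tested. Triples
   containing a star disjoint from u are skipped: they are always compatible. *)
Definition admissible (s : seq nat) : bool :=
  let last_edge v := (size s).-1 \in v in
  let D := [seq v <- stars | all (fun i => i < size s) v] in
  let colours_of := map (map (nth 0 s)) in
  let cD := colours_of D in
  all (fun v => uniq [seq nth 0 s i | i <- v & i < size s])
      [seq v <- stars | last_edge v] &&
  all (fun u => let E := [seq v <- cD | has (mem u) v] in
         all (fun v => all (fun w => compatible u v w && compatible v u w) E) E)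
      (colours_of [seq v <- D | last_edge v]).

(* Colours are normalised so that each edge either gets a previously used colour
   or its own number. *)
Definition extensions (r : seq (seq nat)) : seq (seq nat) :=
  filter admissible
    (flatten [seq [seq rcons s c | c <- rcons (undup s) (size s)] | s <- r]).

(** The sole survivor gives every edge its own number, which is the injective pattern. *)
Lemma search_result : iter 15 extensions [:: [::]] = [:: iota 0 15].
Proof. by apply/eqP; vm_cast_no_check (erefl true). Qed.

(** By induction on [k], the prefix of length [k] of a valid normalised pattern survives [k] rounds,
    because each test of [admissible] is an instance of a constraint on the whole of [s]. *)
Lemma search_sound (s : seq nat) :
    size s = 15 -> (forall k, k < 15 -> nth 0 s k \in rcons (take k s) k) ->
    (forall v, v \in stars -> uniq (map (nth 0 s) v)) ->
    (forall u v w, u \in stars -> v \in stars -> w \in stars ->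
       compatible (map (nth 0 s) u) (map (nth 0 s) v) (map (nth 0 s) w)) ->
  s = iota 0 15.
Proof.
move=> size_s norm_s uniq_s compat_s.
suff take_s k : k <= 15 -> take k s \in iter k extensions [:: [::]].
  have := take_s 15 (leqnn _); rewrite search_result take_oversize ?size_s //.
  by rewrite inE => /eqP.
elim: k => [_|k IHk lt_k]; first by rewrite take0 inE.
have lt_ks : k < size s by rewrite size_s.
have size_k : size (take k.+1 s) = k.+1 by rewrite size_takel // size_s.
rewrite iterS; move: (iter k _ _) (IHk (ltnW lt_k)) => r r_s.
rewrite mem_filter; apply/andP; split; last first.
  apply/flattenP; eexists; first exact: map_f r_s.
  rewrite (take_nth 0) // map_f // size_takel ?(ltnW lt_ks) //.
  by have := norm_s k lt_k; rewrite !mem_rcons !in_cons mem_undup.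
(* On stars whose edges are all coloured already, the prefix and [s] give the same colours. *)
have nth_k v : all (fun i => i < k.+1) v ->
    map (nth 0 (take k.+1 s)) v = map (nth 0 s) v.
  by move/allP=> v_lt; apply/eq_in_map => i /v_lt lt_i; rewrite nth_take.
rewrite /admissible size_k; apply/andP; split.
  apply/allP=> v; rewrite mem_filter => /andP[_ v_star].
  rewrite nth_k ?filter_all //; apply: subseq_uniq (uniq_s v v_star).
  exact/map_subseq/filter_subseq.
set D := [seq v <- stars | _]; set cD := map _ D.
have memC v : v \in cD -> exists2 v', v' \in stars & v = map (nth 0 s) v'.
  case/mapP=> v'; rewrite mem_filter => /andP[v'_lt v'_star] ->.
  by exists v'; rewrite ?nth_k.
apply/allP=> u u_new.
have /memC[u' u'_star ->] : u \in cD.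
  have /mapP[u' + ->] := u_new; rewrite mem_filter => /andP[_ u'D].
  exact: map_f.
apply/allP=> v; rewrite mem_filter => /andP[_ /memC[v' v'_star ->]].
apply/allP=> w; rewrite mem_filter => /andP[_ /memC[w' w'_star ->]].
by rewrite !compat_s.
Qed.

(** * The Petersen graph: numbering, cubicity, absence of bridges *)

(** The order realises the numbering used in [stars]; [o], [s], [i] denote outer edges, spokes and
    inner edges. *)
Definition petersen_edges : seq (edge petersen) :=
  let o k : edge petersen := inl (inl (inZp k)) in
  let s k : edge petersen := inl (inr (inZp k)) in
  let i k : edge petersen := inr (inZp k) in
  [:: o 0; o 4; s 0; s 3; i 1; i 3; i 0; s 1; i 4; o 1; o 3; s 4; o 2; i 2; s 2].

Definition petersen_edge (k : nat) : edge petersen := nth (inr 0%R) petersen_edges k.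

(** Listed so that the vertex at position [k] has the star at position [k] of [stars]. *)
Definition petersen_vertices : seq (vertex petersen) :=
  let o k : vertex petersen := inl (inZp k) in
  let i k : vertex petersen := inr (inZp k) in
  [:: o 0; i 3; i 0; i 1; o 1; o 4; o 3; i 4; i 2; o 2].

Definition petersen_vertex (k : nat) : vertex petersen := nth (inl 0%R) petersen_vertices k.

Lemma petersen_edges_full e : e \in petersen_edges.
Proof. by case: e => [[]|] [[|[|[|[|[|m]]]]] lt_m5]. Qed.

Lemma petersen_vertices_full x : x \in petersen_vertices.
Proof. by case: x => [] [[|[|[|[|[|m]]]]] lt_m5]. Qed.

Lemma petersen_boundary k : k < 10 ->
  boundary (petersen_vertex k) =i
    map petersen_edge (nth [::] stars k).
Proof.
by case: k => [|[|[|[|[|[|[|[|[|[|k]]]]]]]]]] // _ e; rewrite inE;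
  case: e => [[]|] [[|[|[|[|[|m]]]]] lt_m5] //; rewrite /= !inE.
Qed.


Lemma star_vertex v : v \in stars ->
  exists x : vertex petersen, boundary x =i map petersen_edge v.
Proof.
case/(nthP [::])=> k lt_k <-.
by exists (petersen_vertex k); apply: petersen_boundary.
Qed.

Lemma star_uniq v : v \in stars -> uniq (map petersen_edge v) /\ size v = 3.
Proof.
have: all (fun v => uniq (map petersen_edge v) && (size v == 3)) stars by [].
by move=> /allP P /P /andP[Uv /eqP].
Qed.

Lemma star_bound v i : v \in stars -> i \in v -> i < 15.
Proof.
have: all (all (fun i => i < 15)) stars by [].
by move=> /allP P /P /allP; apply.
Qed.

Lemma petersen_cubic : cubic petersen.
Proof.
move=> x; have /(nthP (inl 0%R))[k lt_k <-] := petersen_vertices_full x.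
have [Uv sz_v] := star_uniq (mem_nth [::] (lt_k : k < size stars)).
by rewrite /degree (eq_card (petersen_boundary lt_k)) (card_uniqP Uv) size_map.
Qed.

(** A finite check on indices: no star in the list contains another one. *)
Lemma petersen_boundary_inj : injective (@boundary petersen).
Proof.
move=> x y; have /(nthP (inl 0%R))[k lt_k <-] := petersen_vertices_full x.
have /(nthP (inl 0%R))[l lt_l <-] := petersen_vertices_full y => Dkl.
pose P := fun k l => all (mem (map petersen_edge (nth [::] stars k)))
  (map petersen_edge (nth [::] stars l)) ==> (k == l).
have /allP P_k : all (fun k => all (P k) (iota 0 10)) (iota 0 10) by [].
have /allP/(_ l) : all (P k) (iota 0 10) by apply: P_k; rewrite mem_iota.
rewrite mem_iota => /(_ lt_l)/implyP P_kl; congr (nth _ _ _); apply/eqP/P_kl.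
apply/allP => e.
by rewrite -(petersen_boundary lt_l) -[boundary _]Dkl (petersen_boundary lt_k).
Qed.

(** Every edge lies on a 5-cycle. Outer edges and spokes use the cycle through outer [i], outer
    [i + 1], inner [i + 1], inner [i + 3], inner [i]; inner edges use the one through inner [i],
    inner [i + 2] and the outer path from [i + 2] back to [i]. *)
Lemma petersen_bridgeless : bridgeless petersen.
Proof.
have i5 (i : 'Z_5) : (i + 3%:R + 2%:R = i)%R.
  by apply: val_inj; case: i => [[|[|[|[|[|m]]]]] lt_m5].
have i31 (i : 'Z_5) : (i + 3%:R = i + 1 + 2%:R)%R.
  by apply: val_inj; case: i => [[|[|[|[|[|m]]]]] lt_m5].
have i2 (i : 'Z_5) : (i + 1 + 1 = i + 2%:R)%R by rewrite -GRing.addrA.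
have ne_i1 (i : 'Z_5) : (i + 1)%R != i.
  by case: i => [[|[|[|[|[|m]]]]] lt_m5].
pose out i : edge petersen := inl (inl i).
pose spoke i : edge petersen := inl (inr i).
pose inn i : edge petersen := inr i.
pose vo (i : 'Z_5) : vertex petersen := inl i.
pose vi (i : 'Z_5) : vertex petersen := inr i.
move=> e.
have symc : connect_sym (adj_by [set~ e]).
  by apply: sym_connect_sym; apply: adj_by_sym.
have step e' x y : e' != e -> ends e' = [set x; y] -> connect (adj_by [set~ e]) x y.
  by move=> ne De'; apply/connect1/existsP; exists e'; rewrite !inE ne De' eqxx.
have s_out i : out i != e -> connect (adj_by [set~ e]) (vo i) (vo (i + 1)%R).
  by move/step; apply.
have s_spoke i : spoke i != e -> connect (adj_by [set~ e]) (vo i) (vi i).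
  by move/step; apply.
have s_inn i : inn i != e -> connect (adj_by [set~ e]) (vi i) (vi (i + 2%:R)%R).
  by move/step; apply.
have back3 i : (forall j, inn j != e) ->
    connect (adj_by [set~ e]) (vi (i + 1)%R) (vi i).
  move=> inn_e; apply: connect_trans (s_inn _ (inn_e _)) _.
  by have := s_inn _ (inn_e (i + 3%:R)%R); rewrite i5 i31.
case: e => [[i|i]|i] in symc step s_out s_spoke s_inn back3 *.
- apply: (@not_bridge _ _ (vo i) (vo (i + 1)%R)) => //.
  apply: connect_trans (s_spoke i _) _ => //.
  rewrite symc; apply: connect_trans (s_spoke _ _) _ => //.
  exact: back3.
- apply: (@not_bridge _ _ (vo i) (vi i)) => //.
  apply: connect_trans (s_out i _) _ => //.
  apply: connect_trans (s_spoke _ _) _; first by apply: (contra_neq _ (ne_i1 i)) => -[].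
  exact: back3.
apply: (@not_bridge _ _ (vi i) (vi (i + 2%:R)%R)) => //.
rewrite symc; apply: connect_trans (_ : connect _ (vo (i + 1 + 1)%R) _) => /=.
  by rewrite i2 symc s_spoke.
rewrite symc; apply: connect_trans (_ : connect _ _ (vo i)) _ => /=.
  by rewrite symc s_spoke.
by apply: connect_trans (s_out _ _) _; rewrite // s_out.
Qed.

(** * From the search to the theorem *)

Lemma petersen_colouring_injective (H : mgraph) (f : edge petersen -> edge H) :
    colouring f ->
    (forall u v w, u \in stars -> v \in stars -> w \in stars ->
       compatible (map (f \o petersen_edge) u) (map (f \o petersen_edge) v)
                  (map (f \o petersen_edge) w)) ->
  injective f.
Proof.
move=> f_col f_compat; pose cs := map f petersen_edges.
pose h c := index c (cs ++ enum (edge H)); pose s := map h cs.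
have h_inj : injective h.
  move=> c d; apply: (index_inj c); by rewrite mem_cat mem_enum orbT.
have nth_s i : i < 15 -> nth 0 s i = h (f (petersen_edge i)).
  by move=> lt_i; rewrite (nth_map (f (inr 0%R))) // (nth_map (inr 0%R)).
have map_s v : v \in stars -> map (nth 0 s) v = map h (map (f \o petersen_edge) v).
  move=> v_star; rewrite -map_comp; apply/eq_in_map => i iv.
  by rewrite nth_s ?(star_bound v_star).
have : s = iota 0 15.
  apply: search_sound => [|k lt_k|v v_star|u v w u_star v_star w_star] //.
  - rewrite mem_rcons inE nth_s //; set c := f _.
    have c_cs : c \in cs by apply/map_f/mem_nth.
    have Dk : nth c cs k = c by rewrite (nth_map (inr 0%R)).
    have le_k : h c <= k.
      rewrite /h index_cat c_cs leqNgt; apply/negP => /(before_find c) /=.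
      by rewrite Dk eqxx.
    (* Either edge [k] is the first with its colour and gets its own number, or the code already
       occurs in the prefix, at position [h c]. *)
    case: ltngtP le_k => // lt_ck _ /=.
    have : nth 0 s (h c) = h c.
      rewrite (nth_map c); last exact: leq_trans lt_ck (ltnW lt_k).
      by congr h; rewrite /h index_cat c_cs nth_index.
    move=> <-; rewrite -(nth_take 0 lt_ck) mem_nth // size_takel //.
    exact: ltnW.
  - have [x Dx] := star_vertex v_star; have [Uv _] := star_uniq v_star.
    rewrite map_s // map_inj_uniq // map_comp map_inj_in_uniq // => e1 e2.
    by rewrite -!Dx; apply: colouring_inj_boundary.
  by rewrite !map_s // compatible_map // f_compat.
move/(congr1 uniq); rewrite iota_uniq => /map_uniq Ucs e1 e2.
have /(nthP (inr 0%R))[i lt_i <-] := petersen_edges_full e1.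
have /(nthP (inr 0%R))[j lt_j <-] := petersen_edges_full e2.
rewrite -!(nth_map _ (f (inr 0%R))) // => /eqP.
by rewrite nth_uniq ?size_map // => /eqP->.
Qed.

Theorem corollary3p4 (H : mgraph) (H_conn : connected H)
    (H_col : forall G : mgraph, bridgeless G -> cubic G -> colours H G) :
  isomorphic H petersen \/ exposes_S4 H.
Proof.
have [f f_col] := H_col _ petersen_bridgeless petersen_cubic.
pose F := map (f \o petersen_edge).
have F_star v : v \in stars ->
    [/\ uniq (F v), size (F v) = 3 & exists a : vertex H, boundary a =i F v].
  move=> v_star; have [x Dx] := star_vertex v_star.
  have [Uv sz_v] := star_uniq v_star; have [a Da] := f_col.2 x.
  split; first 1 last; first by rewrite size_map.
    exists a => c; rewrite -Da /F map_comp.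
    by apply/imsetP/mapP => -[e ex ->]; exists e; rewrite ?Dx // -Dx.
  rewrite /F map_comp map_inj_in_uniq // => e1 e2.
  by rewrite -!Dx; apply: colouring_inj_boundary.
(* The dichotomy of the theorem: compatibility of all triples leads to the Petersen graph, a single
   incompatible triple to [S4]. *)
have [F_compat|] := boolP (all (fun u => all (fun v => all (fun w =>
    compatible (F u) (F v) (F w)) stars) stars) stars).
  left; apply: (inj_colouring_isomorphic f_col) => //.
  - by rewrite card_sum card_ord.
  - exact: petersen_boundary_inj.
  apply: petersen_colouring_injective => // u v w u_star v_star w_star.
  by move/allP/(_ u u_star)/allP/(_ v v_star)/allP/(_ w w_star): F_compat.
case/allPn=> u /F_star[Uu szu [a Da]] /allPn[v /F_star[Uv szv [b Db]]].
case/allPn=> w /F_star[Uw szw [c Dc]] not_compat; right.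
exact: incompatible_exposes Da Db Dc not_compat.
Qed.
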